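(* Let $1<a\le b<n$ be integers. There exists a latin square of order $n$ containing two distinct subsquares of orders $a$ and $b$ respectively if and only if all of the following hold: (a) $n\ge 2b$; (b) if $n=2b+1$ and $a$ is even, then $a\le \frac{2}{3}(b+1)$; (c) if $n=2b$ and $a$ is odd, then $a=b$ or $a\le b/2$.
   Context: A latin square of order $n$ is an $n\times n$ matrix on $n$ symbols in which each symbol occurs exactly once in each row and each column. A subsquare of a latin square $L$ is a submatrix of $L$ (obtained by selecting some set of rows and some set of columns, not necessarily contiguous) that is itself a latin square; its order is its number of rows. *)

(* Defs.v *)
From mathcomp Require Import all_boot all_order all_algebra.

Set Implicit Arguments.
Unset Strict Implicit.
Unset Printing Implicit Defensive.

(* The submatrix of L with row set R and column set C is a latin square on the
   symbol set S. *)
Definition latin_on (m n : nat) (T : finType) (L : 'M[T]_(m, n))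
    (R : {set 'I_m}) (C : {set 'I_n}) (S : {set T}) : Prop :=
  [/\ #|R| = #|S|, #|C| = #|S|,
      {in R & C, forall i j, L i j \in S},
      {in R & S, forall i s, #|[set j in C | L i j == s]| = 1}
    & {in C & S, forall j s, #|[set i in R | L i j == s]| = 1}].

Definition latin_square (n : nat) (L : 'M['I_n]_n) : Prop :=
  latin_on L [set: 'I_n] [set: 'I_n] [set: 'I_n].

(* A submatrix is identified with its pair (row set, column set), so that
   distinct submatrices are distinct pairs. *)
Definition subsquare (n : nat) (L : 'M['I_n]_n) (k : nat)
    (Q : {set 'I_n} * {set 'I_n}) : Prop :=
  #|Q.1| = k /\ exists S : {set 'I_n}, latin_on L Q.1 Q.2 S.

(* Main.v *)
(** Amalgamate a latin square along partitions of its rows, columns and symbols: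
    the number of cells in each (row class, column class, symbol class) is an
    "outline", a three-dimensional array of natural numbers whose line sums are
    products of class sizes. Conversely (Hilton) every outline comes from a latin
    square: refine one coordinate at a time, each time splitting an integer
    matrix with row sums [p * q j] and column sums [p * s k] into [p] matrices
    with row sums [q j] and column sums [s k], which is a transportation problem.
    Hence the theorem is a question about outlines on four classes, given by
    membership in A and membership in B. Being a subsquare means that no cell has
    exactly two of its three coordinates in it; necessity is arithmetic with these
    zeros. For sufficiency, an outline symmetric in its three coordinates is
    determined by the four class sizes, and the size of the intersection of A and
    B can be chosen so that it is nonnegative. *)
Require Import Defs.
From mathcomp Require Import all_boot all_order all_algebra.
From mathcomp Require Import zify.

Set Implicit Arguments.
Unset Strict Implicit.
Unset Printing Implicit Defensive.

Import Order.TTheory GRing.Theory Num.Theory.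

(** * Integral transportation *)

Section SupplyDemand.
Variables J K : finType.
Implicit Types (M : J -> K -> nat) (A : {set J}) (B : {set K}).

(** The capacity of the cut of the bipartite network that has [A] and [B] on the source side,
    restricted to the edges from [J] to [K]. *)
Definition cross M A B := \sum_(j in A) \sum_(k in ~: B) M j k.

Lemma cross_indicator M A B :
  cross M A B = \sum_j \sum_k (j \in A) * (k \notin B) * M j k.
Proof.
rewrite /cross big_mkcond; apply: eq_bigr => j _; case: (j \in A) => /=.
  rewrite big_mkcond; apply: eq_bigr => k _; rewrite inE.
  by case: (k \in B); rewrite /= ?mul0n ?mul1n.
by rewrite big1 // => k _; rewrite !mul0n.
Qed.

(** The inequality holds for each edge separately, by cases on the memberships of its two ends. *)
Lemma cross_submodular M A A' B B' :
  cross M (A :&: A') (B :&: B') + cross M (A :|: A') (B :|: B') <=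
  cross M A B + cross M A' B'.
Proof.
rewrite !cross_indicator -!big_split /=; apply: leq_sum => j _.
rewrite -!big_split /=; apply: leq_sum => k _; rewrite -!mulnDl leq_mul2r !inE.
by do 4!case: (_ \in _); rewrite /= ?orbT.
Qed.

Lemma sum_setUI (T : finType) (f : T -> int) (A B : {set T}) :
  (\sum_(i in A :&: B) f i + \sum_(i in A :|: B) f i =
   \sum_(i in A) f i + \sum_(i in B) f i)%R.
Proof.
have E C : (\sum_(i in C) f i = \sum_i (if i \in C then f i else 0))%R.
  exact: big_mkcond.
rewrite !E -!big_split; apply: eq_bigr => i _ /=; rewrite !inE.
by do 2!case: (_ \in _); rewrite /= ?addr0 ?add0r.
Qed.

Lemma sum_setT (T : finType) (f : T -> int) :
  (\sum_(i in [set: T]) f i = \sum_i f i)%R.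
Proof. by apply: eq_bigl => i; rewrite inE. Qed.

Lemma sum_setC1 (T : finType) (f : T -> int) (i0 : T) :
  (\sum_(i in [set~ i0]) f i = \sum_i f i - f i0)%R.
Proof.
rewrite [X in (_ = X - _)%R](bigD1 i0) // [RHS]addrAC subrr add0r.
by apply: eq_bigl => i; rewrite !inE.
Qed.

Lemma sum_dec (T : finType) (f : T -> int) (i0 : T) (A : {set T}) :
  (\sum_(i in A) (f i - (i == i0)%:Z) = \sum_(i in A) f i - (i0 \in A)%:Z)%R.
Proof.
rewrite sumrB; congr (_ - _)%R; have [iA|iA] /= := boolP (i0 \in A).
  by rewrite (bigD1 i0) //= eqxx big1 // => i /andP[_ /negPf ->].
by rewrite big1 // => i iA'; case: eqP => // e; rewrite -e iA' in iA.
Qed.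

Definition decm M j0 k0 j k := M j k - ((j == j0) && (k == k0)).

Lemma sum_decm M j0 k0 (P : pred J) (Q : pred K) : 0 < M j0 k0 ->
  \sum_(j | P j) \sum_(k | Q k) M j k =
  \sum_(j | P j) \sum_(k | Q k) decm M j0 k0 j k + (P j0 && Q k0).
Proof.
move=> M0.
have -> : \sum_(j | P j) \sum_(k | Q k) M j k = \sum_(j | P j) \sum_(k | Q k)
    (decm M j0 k0 j k + ((j == j0) && (k == k0))).
  apply: eq_bigr => j _; apply: eq_bigr => k _; rewrite /decm subnK //.
  by do 2!case: eqP => //= ->.
under eq_bigr do rewrite big_split /=.
rewrite big_split /=; congr (_ + _).
have H1 j : \sum_(k | Q k) ((j == j0) && (k == k0)) = (j == j0) && Q k0.
  case: (j == j0) => /=; last by rewrite big1.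
  case q0 : (Q k0); last by rewrite big1 // => k; case: eqP => // ->; rewrite q0.
  by rewrite (bigD1 k0) //= eqxx big1 // => k /andP[_ /negPf ->].
under eq_bigr do rewrite H1.
case q0 : (Q k0); last by rewrite andbF big1 // => j _; rewrite andbF.
rewrite andbT; case p0 : (P j0).
  by rewrite (bigD1 j0) //= eqxx big1 // => j /andP[_ /negPf ->].
by rewrite big1 // => j; case: eqP => // ->; rewrite p0.
Qed.

(** Gale's feasibility condition: the supply of [A] must cross the cut or be absorbed by [B]. Values
    are integers because sending one unit might make a supply or demand negative; given equal
    totals, the cuts with [B] full or [A] empty exclude this. *)
Definition cut_condition M (q : J -> int) (s : K -> int) := forall A B,
  (\sum_(j in A) q j <= (cross M A B)%:Z + \sum_(k in B) s k)%R.

Lemma cut_conditionP M q s : cut_condition M q s \/ exists A B,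
  ((cross M A B)%:Z + \sum_(k in B) s k < \sum_(j in A) q j)%R.
Proof.
have [/existsP[A /existsP[B h]]|h] := boolP [exists A : {set J}, exists B : {set K},
    ((cross M A B)%:Z + \sum_(k in B) s k < \sum_(j in A) q j)%R].
  by right; exists A, B.
left=> A B; rewrite leNgt; apply: contra h => h.
by apply/existsP; exists A; apply/existsP; exists B.
Qed.

(* Induction on the total capacity: for an edge of positive capacity, either lower
   its capacity or send one unit through it. If both break the cut condition, then
   submodularity applied to the two violating cuts contradicts the cut condition. *)
Lemma supply_demand M (q : J -> int) (s : K -> int) :
  (\sum_j q j = \sum_k s k)%R -> cut_condition M q s ->
  exists Y : J -> K -> nat,
    [/\ forall j k, Y j k <= M j k,
        forall j, Posz (\sum_k Y j k) = q j & forall k, Posz (\sum_j Y j k) = s k].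
Proof.
move: {2}(\sum_j \sum_k M j k) (leqnn (\sum_j \sum_k M j k)) => N.
elim: N M q s => [|N IHN] M q s leN qs cutM.
  have M0 j k : M j k = 0.
    move: leN; rewrite leqn0 sum_nat_eq0 => /forallP/(_ j)/=.
    by rewrite sum_nat_eq0 => /forallP/(_ k)/= /eqP.
  have c0 A B : cross M A B = 0.
    by rewrite /cross big1 // => j _; rewrite big1.
  (* Without capacity, the cuts at one vertex and at its complement bound [q j], and likewise [s k],
     by 0 from both sides. *)
  exists (fun _ _ => 0); split=> // [j|k]; rewrite big1 //.
    have := cutM [set j] set0; have := cutM [set~ j] [set: K].
    rewrite !c0 big_set1 big_set0 sum_setT sum_setC1 -qs; lia.
  have := cutM set0 [set k]; have := cutM [set: J] [set~ k].
  rewrite !c0 big_set1 big_set0 sum_setT sum_setC1 qs; lia.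
have [M0|] := eqVneq (\sum_j \sum_k M j k) 0.
  by apply: IHN; rewrite // M0.
rewrite sum_nat_eq0 negb_forall => /existsP[j0 /=].
rewrite sum_nat_eq0 negb_forall => /existsP[k0 /=].
rewrite -lt0n => Mp.
set M' := decm M j0 k0.
pose q' j := (q j - (j == j0)%:Z)%R; pose s' k := (s k - (k == k0)%:Z)%R.
have leN' : \sum_j \sum_k M' j k <= N.
  by move: leN; rewrite (sum_decm predT predT Mp) /= addn1.
have crossE A B : cross M A B = cross M' A B + (j0 \in A) && (k0 \notin B).
  by rewrite /cross (sum_decm _ _ Mp) inE.
have qs' : (\sum_j q' j = \sum_k s' k)%R.
  by rewrite -!sum_setT !sum_dec !inE !sum_setT qs.
case: (cut_conditionP M' q s) => [cut1|[A [B hAB]]].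
  have [Y [YM Yq Ys]] := IHN M' q s leN' qs cut1.
  by exists Y; split=> // j k; apply: leq_trans (YM j k) (leq_subr _ _).
case: (cut_conditionP M' q' s') => [cut2|[A' [B' hAB']]].
  have [Y [YM Yq Ys]] := IHN M' q' s' leN' qs' cut2.
  pose Z j k := Y j k + ((j == j0) && (k == k0)).
  have Zd : decm Z j0 k0 =2 Y by move=> j k; rewrite /decm /Z addnK.
  have Z0 : 0 < Z j0 k0 by rewrite /Z !eqxx addn1.
  exists Z; split=> [j k|j|k].
  - rewrite /Z; have := YM j k; rewrite /M' /decm.
    case: andP => [[/eqP -> /eqP ->]|_]; lia.
  - have := Yq j; rewrite /q' /Z big_split /=.
    have -> : \sum_k ((j == j0) && (k == k0)) = (j == j0).
      case: (j == j0) => /=; last by rewrite big1.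
      by rewrite (bigD1 k0) //= eqxx big1 // => k /negPf ->.
    lia.
  - have := Ys k; rewrite /s' /Z big_split /=.
    have -> : \sum_j ((j == j0) && (k == k0)) = (k == k0).
      case: (k == k0) => /=; last by rewrite big1 // => j _; rewrite andbF.
      by rewrite (bigD1 j0) //= eqxx big1 // => j /negPf ->.
    lia.
(* As [M] satisfies the cut condition, [j0] is in [A] and [k0] outside [B], while [j0] is outside
   [A'] and [k0] in [B']. So the edge crosses neither the intersection nor the union, and lowering
   it changes nothing there; but the first cut falls short by 1 and the second is tight. *)
exfalso.
have := cross_submodular M' A A' B B'.
have := cutM (A :&: A') (B :&: B'); have := cutM (A :|: A') (B :|: B').
have := cutM A B; have := cutM A' B'.
have := sum_setUI q A A'; have := sum_setUI s B B'.
rewrite /q' /s' !sum_dec in hAB'.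
rewrite !crossE !inE; move: hAB hAB'.
set g1 := cross _ _ _; set g2 := cross _ _ _.
case: (j0 \in A); case: (j0 \in A'); case: (k0 \in B); case: (k0 \in B') => /=; lia.
Qed.

End SupplyDemand.

(** * Outlines and latin squares *)

(** Dividing [M] by [p.+1] gives a fractional solution, which forces the cut condition; an integral
    solution below [M] follows. *)
Lemma matrix_extract (J K : finType) (p : nat) (M : J -> K -> nat)
    (q : J -> nat) (s : K -> nat) :
  (forall j, \sum_k M j k = p.+1 * q j) ->
  (forall k, \sum_j M j k = p.+1 * s k) ->
  exists Y : J -> K -> nat,
    [/\ forall j k, Y j k <= M j k,
        forall j, \sum_k Y j k = q j & forall k, \sum_j Y j k = s k].
Proof.
move=> Mq Ms.
have natz (T : finType) (A : {set T}) (f : T -> nat) :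
    (\sum_(i in A) (f i)%:Z)%R = Posz (\sum_(i in A) f i).
  by elim/big_rec2: _ => // i u v _ ->.
have [] := @supply_demand _ _ M (fun j => Posz (q j)) (fun k => Posz (s k)).
- rewrite -!sum_setT !natz; congr Posz; apply/eqP.
  rewrite -(eqn_pmul2l (ltn0Sn p)) !big_distrr /=.
  under eq_bigr do rewrite -Mq.
  under [X in _ == X]eq_bigr do rewrite -Ms.
  under eq_bigl do rewrite inE; under [X in _ == X]eq_bigl do rewrite inE.
  by rewrite exchange_big.
- move=> A B; rewrite !natz -PoszD lez_nat -(leq_pmul2l (ltn0Sn p)) mulnDr.
  rewrite !big_distrr /=; under eq_bigr do rewrite -Mq.
  under [X in _ <= _ + X]eq_bigr do rewrite -Ms.
  have -> : \sum_(j in A) \sum_k M j k =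
      cross M A B + \sum_(j in A) \sum_(k in B) M j k.
    rewrite -big_split; apply: eq_bigr => j _ /=.
    rewrite addnC (bigID (mem B)) /=; congr (_ + _).
    by apply: eq_bigl => k; rewrite !inE.
  have le1 : \sum_(j in A) \sum_(k in B) M j k <= \sum_(k in B) \sum_j M j k.
    rewrite exchange_big; apply: leq_sum => k _ /=.
    by rewrite [X in _ <= X](bigID (mem A)) leq_addr.
  by apply: (leq_add _ le1); rewrite -big_distrr leq_pmull.
by move=> Y [YM Yq Ys]; exists Y; split=> // [j|k]; [case: (Yq j) | case: (Ys k)].
Qed.

Lemma matrix_decompose (T J K : finType) (q : J -> nat) (s : K -> nat)
    (D : {set T}) (M : J -> K -> nat) :
  (forall j, \sum_k M j k = #|D| * q j) ->
  (forall k, \sum_j M j k = #|D| * s k) ->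
  exists Y : T -> J -> K -> nat,
    [/\ {in D, forall t j, \sum_k Y t j k = q j},
        {in D, forall t k, \sum_j Y t j k = s k}
      & forall j k, \sum_(t in D) Y t j k = M j k].
Proof.
move cD : #|D| => p; elim: p D cD M => [|p IHp] D cD M Mq Ms.
  have D0 : D = set0 by apply/eqP; rewrite -cards_eq0 cD.
  exists (fun _ _ _ => 0); rewrite D0; split=> [t|t|j k]; rewrite ?inE //.
  have /eqP := Mq j; rewrite big_set0 sum_nat_eq0 => /forallP/(_ k) /= /eqP.
  by [].
have /card_gt0P[t0 t0D] : 0 < #|D| by rewrite cD.
have [Y0 [Y0M Y0q Y0s]] := matrix_extract Mq Ms.
have [|||Y [Yq Ys YM]] := IHp (D :\ t0) _ (fun j k => M j k - Y0 j k) => //.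
- by apply/eqP; rewrite -eqSS -cD (cardsD1 t0 D) t0D.
- by move=> j; rewrite sumnB // Mq Y0q mulSn addKn.
- by move=> k; rewrite sumnB // Ms Y0s mulSn addKn.
exists (fun t => if t == t0 then Y0 else Y t); split=> [t tD|t tD|j k].
- by case: eqP => // /eqP tt0; apply: Yq; rewrite !inE tt0.
- by case: eqP => // /eqP tt0; apply: Ys; rewrite !inE tt0.
rewrite (big_setD1 t0) //= eqxx -[RHS](subnKC (Y0M j k)) -YM; congr (_ + _).
by apply: eq_bigr => t; rewrite !inE => /andP[/negPf ->].
Qed.

Lemma outline_split (T I J K : finType) (rho : T -> I)
    (x : I -> J -> K -> nat) (q : J -> nat) (s : K -> nat) :
  (forall i j, \sum_k x i j k = #|rho @^-1: [set i]| * q j) ->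
  (forall i k, \sum_j x i j k = #|rho @^-1: [set i]| * s k) ->
  exists y : T -> J -> K -> nat,
    [/\ forall t j, \sum_k y t j k = q j,
        forall t k, \sum_j y t j k = s k
      & forall i j k, \sum_(t | rho t == i) y t j k = x i j k].
Proof.
move=> xq xs.
have /fin_all_exists[Y YP] i := matrix_decompose (xq i) (xs i).
exists (fun t => Y (rho t) t); split=> [t j|t k|i j k].
- by have [h _ _] := YP (rho t); apply: h; rewrite !inE.
- by have [_ h _] := YP (rho t); apply: h; rewrite !inE.
have [_ _ <-] := YP i; apply: eq_big => [t|t /eqP -> //].
by rewrite !inE.
Qed.

Definition outline (I J K : finType) (x : I -> J -> K -> nat)
    (u : I -> nat) (v : J -> nat) (w : K -> nat) :=
  [/\ forall i j, \sum_k x i j k = u i * v j,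
      forall i k, \sum_j x i j k = u i * w k
    & forall j k, \sum_i x i j k = v j * w k].

Lemma sum_refine (T I : finType) (rho : T -> I) (f : T -> nat) (g : I -> nat) :
  (forall i, \sum_(t | rho t == i) f t = g i) -> \sum_t f t = \sum_i g i.
Proof.
by move=> fg; rewrite (partition_big rho predT) //=; apply: eq_bigr.
Qed.

(** Rows, columns and symbols are split in turn, with the coordinates permuted to bring the current
    one first. In the end all line sums are 1, so the array is the indicator of a latin square. Only
    positivity of [x] at occupied triples is retained: subsquares are encoded by zeros. *)
Lemma outline_lift (n : nat) (I J K : finType) (rho : 'I_n -> I)
    (sigma : 'I_n -> J) (tau : 'I_n -> K) (x : I -> J -> K -> nat) :
  outline x (fun i => #|rho @^-1: [set i]|) (fun j => #|sigma @^-1: [set j]|)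
    (fun k => #|tau @^-1: [set k]|) ->
  exists2 L : 'M['I_n]_n, latin_square L &
    forall r c, 0 < x (rho r) (sigma c) (tau (L r c)).
Proof.
case=> xw xv xu.
have [y1 [y1w y1v y1x]] := outline_split xw xv.
have y1u j k : \sum_r y1 r j k = #|sigma @^-1: [set j]| * #|tau @^-1: [set k]|.
  by rewrite -xu; apply: (sum_refine (rho := rho)).
have [||y2 [y2w y2u y2x]] := @outline_split _ _ _ _ sigma (fun j r k => y1 r j k)
    (fun=> 1) (fun k => #|tau @^-1: [set k]|).
- by move=> j r; rewrite y1w muln1.
- by move=> j k; rewrite y1u.
have y2v r k : \sum_c y2 c r k = #|tau @^-1: [set k]|.
  by rewrite -(y1v r); apply: (sum_refine (rho := sigma)).
have [||z [z1 z2 zx]] := @outline_split _ _ _ _ tau (fun k r c => y2 c r k)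
    (fun=> 1) (fun=> 1).
- by move=> k r; rewrite y2v muln1.
- by move=> k c; rewrite y2u muln1.
have z3 r c : \sum_e z e r c = 1.
  by rewrite -(y2w c r); apply: (sum_refine (rho := tau)).
have zP r c : exists e, 0 < z e r c.
  apply/existsP; apply: contraT; rewrite negb_exists => /forallP z0.
  have := z3 r c; rewrite big1 // => e _; apply/eqP; rewrite -leqn0 leqNgt.
  exact: z0.
pose L : 'M['I_n]_n := (\matrix_(r, c) xchoose (zP r c))%R.
have zE e r c : z e r c = (L r c == e) :> nat.
  rewrite mxE; have := xchooseP (zP r c); set e0 := xchoose _ => e0P.
  have := z3 r c; rewrite (bigD1 e0) //=.
  have [<-|ne] := eqVneq e0 e; first by move: e0P; case: (z e0 r c) => [|[|]].
  rewrite (bigD1 e) /= 1?eq_sym //; case: (z e0 r c) e0P => // k _.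
  by case: (z e r c) => // k'; rewrite addSn addnS.
exists L; last first.
  move=> r c; have : 0 < z (L r c) r c by rewrite zE eqxx.
  move=> /leq_trans; apply.
  rewrite -y1x (bigD1 r) //=; apply: leq_trans (leq_addr _ _).
  rewrite -y2x (bigD1 c) //=; apply: leq_trans (leq_addr _ _).
  by rewrite -zx (bigD1 (L r c)) //= leq_addr.
split=> //.
- by move=> r e _ _; rewrite -[RHS](z1 e r) -sum1_card big_mkcond; apply: eq_bigr => c _;
    rewrite !inE zE; case: eqP.
- by move=> c e _ _; rewrite -[RHS](z2 e c) -sum1_card big_mkcond; apply: eq_bigr => r _;
    rewrite !inE zE; case: eqP.
Qed.

Lemma latin_outline (n : nat) (I J K : finType) (rho : 'I_n -> I)
    (sigma : 'I_n -> J) (tau : 'I_n -> K) (L : 'M['I_n]_n) : latin_square L ->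
  outline (fun i j k => \sum_(r | rho r == i) \sum_(c | sigma c == j)
        \sum_(e | tau e == k) (L r c == e))
    (fun i => #|rho @^-1: [set i]|) (fun j => #|sigma @^-1: [set j]|)
    (fun k => #|tau @^-1: [set k]|).
Proof.
case=> _ _ _ L1 L2.
have S1 r e : \sum_c (L r c == e) = 1.
  rewrite -(L1 r e) ?inE // -sum1_card [RHS]big_mkcond.
  by apply: eq_bigr => c _; rewrite !inE; case: eqP.
have S2 c e : \sum_r (L r c == e) = 1.
  rewrite -(L2 c e) ?inE // -sum1_card [RHS]big_mkcond.
  by apply: eq_bigr => r _; rewrite !inE; case: eqP.
have S3 r c : \sum_e (L r c == e) = 1.
  rewrite (bigD1 (L r c)) //= eqxx big1 // => e; rewrite eq_sym.
  by move/negPf ->.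
have cardE (T : finType) (f : 'I_n -> T) (i : T) :
    \sum_(r | f r == i) 1 = #|f @^-1: [set i]|.
  by rewrite -sum1_card; apply: eq_bigl => r; rewrite !inE.
split=> [i j|i k|j k].
- rewrite exchange_big /= -!cardE big_distrl; apply: eq_bigr => r _ /=.
  rewrite exchange_big /= mul1n; apply: eq_bigr => c _.
  by rewrite -(S3 r c) [RHS](sum_refine (rho := tau) (g := fun k =>
    \sum_(e | tau e == k) (L r c == e))).
- rewrite exchange_big /= -!cardE big_distrl; apply: eq_bigr => r _ /=.
  under eq_bigr do rewrite exchange_big /=.
  rewrite exchange_big /= mul1n; apply: eq_bigr => e _.
  by rewrite -(S1 r e) [RHS](sum_refine (rho := sigma) (g := fun k =>
    \sum_(c | sigma c == k) (L r c == e))).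
under eq_bigr do rewrite exchange_big /=.
rewrite exchange_big /= -!cardE big_distrl; apply: eq_bigr => c _ /=.
under eq_bigr do rewrite exchange_big /=.
rewrite exchange_big /= mul1n; apply: eq_bigr => e _.
by rewrite -(S2 c e) [RHS](sum_refine (rho := rho) (g := fun k =>
  \sum_(r | rho r == k) (L r c == e))).
Qed.

(** * Necessity *)

Lemma sum_bool2 (f : bool * bool -> nat) :
  \sum_c f c = f (true, true) + f (true, false) + f (false, true) + f (false, false).
Proof.
have -> : \sum_c f c = \sum_p \sum_q f (p, q).
  by rewrite pair_bigA; apply: eq_bigr => -[].
by rewrite !big_bool /= addnA.
Qed.

Section TwoSubsquaresNecessary.
Variables (a b t : nat).
Implicit Types (x : bool * bool -> bool * bool -> bool * bool -> nat).
Implicit Types (u v w : bool * bool -> nat).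

(** The first Boolean is membership in A, the second membership in B. With [n = 2 * b + t], the
    complement of B has [b + t] elements. *)
Definition class_sizes u :=
  [/\ u (true, true) + u (true, false) = a, u (true, true) + u (false, true) = b
    & u (true, false) + u (false, false) = b + t].

Definition closed_classes x :=
  (forall p q s : bool * bool, p.1 + q.1 + s.1 = 2 -> x p q s = 0) /\
  (forall p q s : bool * bool, p.2 + q.2 + s.2 = 2 -> x p q s = 0).

Definition sized_outline x u v w :=
  [/\ outline x u v w, closed_classes x
    & [/\ class_sizes u, class_sizes v & class_sizes w]].

Lemma sized_outline_swap12 x u v w : sized_outline x u v w ->
  sized_outline (fun q p s => x p q s) v u w.
Proof.
move=> [[xw xv xu] [zA zB] [uP vP wP]]; split=> //.
  by split=> // q p; rewrite mulnC.
by split=> p q s e; [apply: zA|apply: zB]; rewrite -e; lia.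
Qed.

Lemma sized_outline_swap23 x u v w : sized_outline x u v w ->
  sized_outline (fun p s q => x p q s) u w v.
Proof.
move=> [[xw xv xu] [zA zB] [uP vP wP]]; split=> //.
  by split=> // q p; rewrite mulnC.
by split=> p q s e; [apply: zA|apply: zB]; rewrite -e; lia.
Qed.

Ltac clear_zeros zA zB :=
  repeat match goal with |- context [?x (?p1, ?p2) (?q1, ?q2) (?s1, ?s2)] =>
    first [rewrite (zA (p1, p2) (q1, q2) (s1, s2) erefl)
          |rewrite (zB (p1, p2) (q1, q2) (s1, s2) erefl)] end;
  rewrite ?add0n ?addn0.

Notation c1 := (true, true).
Notation c2 := (true, false).
Notation c3 := (false, true).
Notation c4 := (false, false).

(** Fix a symbol class outside B. Rows outside B contain it [(b + t) * w] times; [b * w] of these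
    lie in columns of B, because such a symbol in a column of B forces a row outside B. The
    remaining [t * w] cells are counted on the left. *)
Lemma sized_outline_excess x u v w e : sized_outline x u v w ->
  x c2 c2 (e, false) + x c2 c4 (e, false) +
  x c4 c2 (e, false) + x c4 c4 (e, false) = w (e, false) * t.
Proof.
move=> [[xw xv xu] [zA zB] [[u1 u2 u3] [v1 v2 v3] [w1 w2 w3]]].
have : (u c2 + u c4) * w (e, false) = (b + t) * w (e, false) by rewrite u3.
have : (v c1 + v c3) * w (e, false) = b * w (e, false) by rewrite v2.
rewrite !mulnDl [w _ * t]mulnC.
have := xv c2 (e, false); have := xv c4 (e, false).
have := xu c1 (e, false); have := xu c3 (e, false).
by case: e; rewrite !sum_bool2; clear_zeros zA zB; lia.
Qed.

(** The excess count gives [a * w c2 <= t * w c2], so all symbols of A are symbols of B. A row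
    outside both then carries these [a] symbols in columns outside both, of which there are
    [b + t - a]. *)
Lemma sized_outline_disjoint x u v w : sized_outline x u v w ->
  1 < a -> t <= 1 -> u c1 = 0 -> v c1 = 0 -> a = b /\ t = 0 \/ 2 * a <= b + t.
Proof.
move=> xP a1 t1 u0 v0; have excess := sized_outline_excess true xP.
case: xP => [[xw xv xu] [zA zB] [[u1 u2 u3] [v1 v2 v3] [w1 w2 w3]]].
have w20 : w c2 = 0.
  have := xv c2 c2; have := xw c2 c1; move: excess.
  rewrite !sum_bool2; clear_zeros zA zB; rewrite v0 muln0.
  nia.
have := xv c4 c1; have := xw c4 c4.
rewrite !sum_bool2; clear_zeros zA zB => h1 h2.
have [u40|u4p] := posnP (u c4); [left; lia|right].
nia.
Qed.

(** A row of B outside A can carry the [a] symbols of A only in the [b - a] columns of B outside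
    A. *)
Lemma sized_outline_nested x u v w : sized_outline x u v w ->
  u c1 = a -> v c1 = a -> w c1 = a -> a = b \/ 2 * a <= b.
Proof.
move=> [[xw xv xu] [zA zB] [[u1 u2 u3] [v1 v2 v3] [w1 w2 w3]]] ua va wa.
have := xv c3 c1; have := xw c3 c3.
rewrite !sum_bool2; clear_zeros zA zB => h1 h2.
have [u30|u3p] := posnP (u c3); [left; lia|right].
nia.
Qed.

(** Put [k = u c1] and [l = u c2]. The entry at [c2 c2 c2] is [l * (l - k)], and the excess count
    bounds it by [l * t], so [k <= l <= k + t] while [a = k + l]. If [t = 1] and [a] is even, then
    [l = k] and this entry vanishes; the three excess counts for [c2] then put [2 * k] cells into
    the one for [c4], whence [2 * k <= b + 1 - k]. *)
Lemma sized_outline_crossing x u v w : sized_outline x u v w ->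
  u c1 = v c1 -> u c1 = w c1 -> u c1 < a -> t <= 1 ->
  (t = 0 -> ~~ odd a) /\ (t = 1 -> ~~ odd a -> 3 * a <= 2 * (b + 1)).
Proof.
move=> xP uv uw ua t1; have e1 := sized_outline_excess true xP.
have e4 := sized_outline_excess false xP.
have e2 := sized_outline_excess true (sized_outline_swap23 xP).
have e3 := sized_outline_excess true
  (sized_outline_swap23 (sized_outline_swap12 xP)).
case: xP => [[xw xv xu] [zA zB] [[u1 u2 u3] [v1 v2 v3] [w1 w2 w3]]].
move: e1 e2 e3 e4; clear_zeros zA zB => e1 e2 e3 e4.
have := xw c2 c2; have := xu c2 c1; rewrite !sum_bool2; clear_zeros zA zB.
have -> : v c2 = u c2 by lia.
have u2p : 0 < u c2 by lia.
move=> -> h; have uw2 : u c2 = w c2 by lia.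
have l1 : w c1 <= u c2 by nia.
have l2 : u c2 <= w c1 + t by nia.
split=> t0; first by lia.
move=> aodd; have ueq : w c1 = u c2 by lia.
have x0 : x c2 c2 c2 = 0 by move: h; rewrite ueq; lia.
move: e1 e2 e3 e4; rewrite t0 x0 !muln1; lia.
Qed.

End TwoSubsquaresNecessary.

(** * From a pair of subsquares to a sized outline *)

Lemma eq_pairwise_products (p q r : nat) : p * q = p * r -> p * q = q * r ->
  [\/ p = q /\ p = r, p = 0 /\ q = 0, p = 0 /\ r = 0 | q = 0 /\ r = 0].
Proof.
have [->|p0] := posnP p.
  move=> _ /esym/eqP; rewrite muln_eq0 => /orP[] /eqP ->.
    by constructor 2.
  by constructor 3.
move=> /eqP; rewrite eqn_pmul2l // => /eqP <-.
have [->|q0] := posnP q; first by constructor 4.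
by move=> /eqP; rewrite eqn_pmul2r // => /eqP ->; constructor 1.
Qed.

(** The only occurrence of a symbol of [S] in a row of [R] lies in a column of [C], and dually for
    columns; so two coordinates inside force the third. *)
Lemma latin_on_closed (n : nat) (L : 'M['I_n]_n) (R C S : {set 'I_n}) :
  latin_square L -> latin_on L R C S ->
  forall r c, (r \in R) + (c \in C) + (L r c \in S) <> 2.
Proof.
move=> [_ _ _ L1 L2] [_ _ RCS RS CS] r c.
case rR : (r \in R); case cC : (c \in C); case LS : (L r c \in S) => // _.
- by rewrite RCS in LS.
- have /eqP/cards1P[c' /setP cE] := RS r (L r c) rR LS.
  have /eqP/cards1P[c'' /setP cE'] := L1 r (L r c) (in_setT _) (in_setT _).
  have := cE c'; rewrite !inE eqxx => /andP[c'C Lc'].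
  have := cE' c; have := cE' c'; rewrite !inE eqxx Lc' => /esym/eqP e /esym/eqP e'.
  by rewrite e' -e c'C in cC.
have /eqP/cards1P[r' /setP rE] := CS c (L r c) cC LS.
have /eqP/cards1P[r'' /setP rE'] := L2 c (L r c) (in_setT _) (in_setT _).
have := rE r'; rewrite !inE eqxx => /andP[r'R Lr'].
have := rE' r; have := rE' r'; rewrite !inE eqxx Lr' => /esym/eqP e /esym/eqP e'.
by rewrite e' -e r'R in rR.
Qed.

(** A row outside [R] can carry the symbols of [S] only in columns outside [C]. *)
Lemma latin_on_le_half (n : nat) (L : 'M['I_n]_n) (R C S : {set 'I_n}) :
  latin_square L -> latin_on L R C S -> #|R| < n -> 2 * #|R| <= n.
Proof.
move=> LL RCS Rn; have zero := latin_on_closed LL RCS.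
have [cR cC _ _ _] := RCS.
have := latin_outline (fun i => i \in R) (fun i => i \in C) (fun i => i \in S) LL.
set x := (fun _ _ _ => _).
have z (p q s : bool) : p + q + s = 2 -> x p q s = 0.
  move=> e; rewrite /x big1 // => r /eqP rp; rewrite big1 // => c /eqP cq.
  rewrite big1 // => k /eqP ks; case: eqP => // Lk.
  by case: (zero r c); rewrite Lk rp cq ks.
have cardE (A : {set 'I_n}) : #|[in A] @^-1: [set true]| = #|A|.
  by apply: eq_card => i; rewrite !inE eqb_id.
have cardEC (A : {set 'I_n}) : #|[in A] @^-1: [set false]| + #|A| = n.
  rewrite addnC -[RHS]card_ord -(cardsC A); congr (_ + _).
  by apply: eq_card => i; rewrite !inE eqbF_neg.
case=> xw xv _; have := xv false true; have := xw false false.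
rewrite !big_bool /= (z false true true) // cardE.
move: (cardEC R) (cardEC C) Rn; rewrite cR cC.
move: #|_ @^-1: _| #|_ @^-1: _| #|S| (x false false true) => s s' k y.
move=> sn s'n kn h1 h2; have ss : s' = s by lia.
have : s * k <= s * s by rewrite ss in h1 h2; lia.
by rewrite leq_pmul2l; lia.
Qed.

Lemma card_class_sizes (n a b t : nat) (A B : {set 'I_n}) :
  #|A| = a -> #|B| = b -> n = 2 * b + t ->
  class_sizes a b t
    (fun p => #|(fun i => (i \in A, i \in B)) @^-1: [set p]|).
Proof.
move=> <- cB nB.
have E p q : #|(fun i => (i \in A, i \in B)) @^-1: [set (p, q)]| =
    #|[set i | ((i \in A) == p) && ((i \in B) == q)]|.
  by apply: eq_card => i; rewrite !inE.
have := cardsC B; rewrite card_ord cB => BC.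
split; rewrite !E.
- rewrite -(cardsID B A); congr (_ + _); apply: eq_card => i; rewrite !inE;
  by do 2!case: (_ \in _).
- rewrite -cB -(cardsID A B); congr (_ + _); apply: eq_card => i; rewrite !inE;
  by do 2!case: (_ \in _).
have <- : #|~: B| = b + t by lia.
rewrite -(cardsID A (~: B)); congr (_ + _); apply: eq_card => i; rewrite !inE;
by do 2!case: (_ \in _).
Qed.

Lemma two_subsquares_necessary (n a b : nat) (L : 'M['I_n]_n)
    (A B : {set 'I_n} * {set 'I_n}) :
  latin_square L -> 1 < a -> a <= b -> b < n ->
  subsquare L a A -> subsquare L b B -> A <> B ->
  [/\ 2 * b <= n,
      (n = 2 * b + 1 -> ~~ odd a -> 3 * a <= 2 * (b + 1))
    & (n = 2 * b -> odd a -> a = b \/ 2 * a <= b)].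
Proof.
move=> LL a1 ab bn [cRA [SA LA]] [cRB [SB LB]] AB.
have n2b : 2 * b <= n by rewrite -cRB; apply: latin_on_le_half LB _ => //; rewrite cRB.
(* The first alternative comes from disjoint or nested subsquares, the second from crossing ones. *)
suff main t : n = 2 * b + t -> t <= 1 ->
    (a = b /\ t = 0 \/ 2 * a <= b + t) \/
    (t = 0 -> ~~ odd a) /\ (t = 1 -> ~~ odd a -> 3 * a <= 2 * (b + 1)).
  split=> //; first by move=> /main/(_ isT); lia.
  by move=> nb oa; case: (main 0) => //; lia.
move=> nb t1; case: A B => RA CA [RB CB] /= in cRA LA cRB LB AB *.
pose cl (X Y : {set 'I_n}) i := (i \in X, i \in Y).
have xP := latin_outline (cl RA RB) (cl CA CB) (cl SA SB) LL.
set x := (fun _ _ _ => _) in xP.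
have [cA1 cA2 _ _ _] := LA; have [cB1 cB2 _ _ _] := LB.
have xS : sized_outline a b t x (fun p => #|cl RA RB @^-1: [set p]|)
    (fun p => #|cl CA CB @^-1: [set p]|) (fun p => #|cl SA SB @^-1: [set p]|).
  split=> //; last first.
    by split; apply: card_class_sizes => //; rewrite ?cA2 ?cB2 -?cA1 -?cB1.
  split=> -[p1 p2] [q1 q2] [s1 s2] /= e; rewrite /x big1 // => r /eqP[r1 r2];
    rewrite big1 // => c /eqP[e1 e2]; rewrite big1 // => k /eqP[k1 k2];
    case: eqP => // Lk.
  - by case: (latin_on_closed LL LA (r := r) (c := c)); rewrite Lk r1 e1 k1.
  - by case: (latin_on_closed LL LB (r := r) (c := c)); rewrite Lk r2 e2 k2.
move: (xS) => [[xw xv xu] [zA zB] [[u1 u2 u3] [v1 v2 v3] [w1 w2 w3]]].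
set u := (fun p => _) in xS xw xv u1 u2 u3.
set v := (fun p => _) in xS xw xu v1 v2 v3.
set w := (fun p => _) in xS xu xv w1 w2 w3.
pose c1 := (true, true).
have uv : u c1 * v c1 = x c1 c1 c1.
  by rewrite -xw sum_bool2 (zA c1 c1 (false, _)) // (zA c1 c1 (false, _)) //
    (zB c1 c1 (true, false)) // !addn0.
have uw : u c1 * w c1 = x c1 c1 c1.
  by rewrite -xv sum_bool2 (zA c1 (false, _) c1) // (zA c1 (false, _) c1) //
    (zB c1 (true, false) c1) // !addn0.
have vw : v c1 * w c1 = x c1 c1 c1.
  by rewrite -xu sum_bool2 (zA (false, _) c1 c1) // (zA (false, _) c1 c1) //
    (zB (true, false) c1 c1) // !addn0.
(* All three pairwise products count the cells common to both subsquares, so the common part is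
   square or is empty in two of the three coordinates. *)
have : [\/ u c1 = v c1 /\ u c1 = w c1, u c1 = 0 /\ v c1 = 0,
           u c1 = 0 /\ w c1 = 0 | v c1 = 0 /\ w c1 = 0].
  by apply: eq_pairwise_products; rewrite uv ?uw ?vw.
case=> [[uv1 uw1]|[u0 v0]|[u0 w0]|[v0 w0]].
- have [ua|ua] := eqVneq (u c1) a; last first.
    by right; apply: (sized_outline_crossing xS) => //;
      rewrite ltn_neqAle ua -u1 leq_addr.
  have va : v c1 = a by rewrite -uv1.
  have wa : w c1 = a by rewrite -uw1.
  left; case: (sized_outline_nested xS) => // [abE|]; last by right; lia.
  (* Nested subsquares of equal order have the same rows and columns, hence coincide. *)
  case: AB.
  have setE (X Y : {set 'I_n}) : #|X| = b -> #|Y| = b ->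
      #|cl X Y @^-1: [set c1]| = b -> X = Y.
    move=> cX cY cXY.
    have E : cl X Y @^-1: [set c1] = X :&: Y.
      by apply/setP=> i; rewrite !inE xpair_eqE !eqb_id.
    rewrite E in cXY; transitivity (X :&: Y).
      by apply/esym/eqP; rewrite eqEcard subsetIl cX cXY leqnn.
    by apply/eqP; rewrite eqEcard subsetIr cY cXY leqnn.
  by congr (_, _); apply: setE; rewrite ?cA2 ?cB2 -?cA1 -?cB1 ?cRA ?cRB -?abE.
- by left; apply: (sized_outline_disjoint xS).
- by left; apply: (sized_outline_disjoint (sized_outline_swap23 xS)).
by left; apply: (sized_outline_disjoint
  (sized_outline_swap23 (sized_outline_swap12 xS))).
Qed.

(** * Sufficiency *)

(** Rows and columns of a latin square are injective, so a restriction mapping into a set of the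
    same size is a bijection onto it. *)
Lemma latin_on_of_closed (n : nat) (L : 'M['I_n]_n) (R C S : {set 'I_n}) :
  latin_square L -> #|R| = #|S| -> #|C| = #|S| ->
  {in R & C, forall i j, L i j \in S} -> latin_on L R C S.
Proof.
move=> [_ _ _ L1 L2] RS CS RCS.
have one (f : 'I_n -> 'I_n) (X : {set 'I_n}) s :
    (forall s, #|[set j in [set: 'I_n] | f j == s]| = 1) -> #|X| = #|S| ->
    {in X, forall j, f j \in S} -> s \in S -> #|[set j in X | f j == s]| = 1.
  move=> f1 XS fS sS.
  have f_inj : injective f.
    move=> j j' e; have /eqP/cards1P[j0 /setP E] := f1 (f j).
    have := E j; have := E j'; rewrite !inE -e eqxx.
    by move=> /esym/eqP -> /esym/eqP ->.
  have fX : f @: X = S.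
    apply/eqP; rewrite eqEcard card_imset // XS leqnn andbT.
    by apply/subsetP=> _ /imsetP[j jX ->]; apply: fS.
  move: sS; rewrite -fX => /imsetP[j jX ->]; apply/eqP/cards1P; exists j.
  by apply/setP=> j'; rewrite !inE (inj_eq f_inj); case: eqP => [->|]; rewrite ?andbF ?jX.
split=> // [r s rR sS|c s cC sS].
  by apply: one => // [e|j jC]; [apply: L1; rewrite inE | apply: RCS].
by apply: (one (fun r => L r c)) => // [e|j jR]; [apply: L2; rewrite inE | apply: RCS].
Qed.

Definition class_weight (k l m r : nat) (p : bool * bool) : nat :=
  match p with
  | (true, true) => k | (true, false) => l | (false, true) => m
  | (false, false) => r
  end.

(* The only symmetric array with these zeros and line sums: each entry is forced
   by a line sum in which all other entries are known. The free argument [z] is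
   the entry with all coordinates outside A and B; [symmetric_outline] fixes it. *)
Definition symmetric_counts (k l m r z : nat) (p q s : bool * bool) : nat :=
  let c1 := (true, true) in
  let c n := (p == n) + (q == n) + (s == n) in
  if p == c1 then (q == s) * (k * class_weight k l m r q)
  else if q == c1 then (p == s) * (k * class_weight k l m r p)
  else if s == c1 then (p == q) * (k * class_weight k l m r p)
  else match c (true, false), c (false, true) with
  | 3, 0 => l * (l - k) | 0, 3 => m * (m - k)
  | 1, 1 => l * m | 1, 0 => l * (r - m) | 0, 1 => m * (r - l)
  | 0, 0 => z | _, _ => 0
  end.

(** Each disjunction makes one truncated difference exact or multiplies it by 0. The equation for
    [z] is the line sum with two coordinates outside both A and B. *)
Lemma symmetric_outline (k l m r z : nat) :
  l = 0 \/ k <= l -> m = 0 \/ k <= m -> l = 0 \/ m <= r -> m = 0 \/ l <= r ->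
  z + r * (k + l + m) = r * r + 2 * l * m ->
  let w := class_weight k l m r in outline (symmetric_counts k l m r z) w w w.
Proof.
move=> kl km mr lr zE.
have e1 : l * (l - k) + k * l = l * l.
  by case: kl => [->|kl]; rewrite ?muln0 // mulnC -mulnDl subnK.
have e2 : m * (m - k) + k * m = m * m.
  by case: km => [->|km]; rewrite ?muln0 // mulnC -mulnDl subnK.
have e3 : l * (r - m) + l * m = l * r.
  by case: mr => [->|mr]; rewrite // -mulnDr subnK.
have e4 : m * (r - l) + m * l = m * r.
  by case: lr => [->|lr]; rewrite // -mulnDr subnK.
split=> -[[|] [|]] [[|] [|]]; rewrite sum_bool2 /symmetric_counts /class_weight /=.
all: rewrite ?mul0n ?mul1n ?add0n ?addn0; try lia.
Qed.

(** * Realization of the symmetric outline *)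

Lemma card_ord_interval (n u v : nat) (P : pred 'I_n) : v <= n ->
  (forall i : 'I_n, P i = (u <= i < v)) -> #|[set i | P i]| = v - u.
Proof.
move=> vn PE; rewrite -sum1_card -[RHS]muln1 -sum_nat_const_nat.
rewrite (big_nat_widen _ _ _ _ _ vn) (big_nat_widenl _ 0) //= big_mkord.
by apply: eq_bigl => i; rewrite inE PE andbC.
Qed.

Lemma class_function (k l m r : nat) : exists rho : 'I_(k + l + m + r) -> bool * bool,
  forall c, #|rho @^-1: [set c]| = class_weight k l m r c.
Proof.
exists (fun i => (i < k + l, (i < k) || (k + l <= i < k + l + m))).
move=> [p q].
have -> : forall f : 'I_(k + l + m + r) -> bool * bool,
    f @^-1: [set (p, q)] = [set i | ((f i).1 == p) && ((f i).2 == q)].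
  by move=> f; apply/setP=> i; rewrite !inE.
case: p; case: q => /=.
- by rewrite (@card_ord_interval _ 0 k) => [||i]; try lia;
    have := ltn_ord i; rewrite ?eqb_id ?eqbF_neg; lia.
- by rewrite (@card_ord_interval _ k (k + l)) => [||i]; try lia;
    have := ltn_ord i; rewrite ?eqb_id ?eqbF_neg; lia.
- by rewrite (@card_ord_interval _ (k + l) (k + l + m)) => [||i]; try lia;
    have := ltn_ord i; rewrite ?eqb_id ?eqbF_neg; lia.
by rewrite (@card_ord_interval _ (k + l + m) (k + l + m + r)) => [||i]; try lia;
    have := ltn_ord i; rewrite ?eqb_id ?eqbF_neg; lia.
Qed.

Lemma symmetric_latin_square (k l m r z : nat) :
  l = 0 \/ k <= l -> m = 0 \/ k <= m -> l = 0 \/ m <= r -> m = 0 \/ l <= r ->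
  z + r * (k + l + m) = r * r + 2 * l * m ->
  exists (L : 'M['I_(k + l + m + r)]_(k + l + m + r)) rho,
    [/\ latin_square L, forall c, #|rho @^-1: [set c]| = class_weight k l m r c
      & forall i j, 0 < symmetric_counts k l m r z (rho i) (rho j) (rho (L i j))].
Proof.
move=> kl km mr lr zE; have [rho rhoE] := class_function k l m r.
have [xw xv xu] := symmetric_outline kl km mr lr zE.
have [|L LL Lx] := @outline_lift _ _ _ _ rho rho rho (symmetric_counts k l m r z).
  by split=> *; rewrite !rhoE ?xw ?xv ?xu.
by exists L, rho.
Qed.

(** Each subsquare uses one index set for rows, columns and symbols. The inequality makes [z]
    nonnegative, and [0 < l + m] keeps the two index sets distinct. *)
Lemma two_subsquares_of_weights (n k l m r : nat) : n = k + l + m + r ->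
  l = 0 \/ k <= l -> m = 0 \/ k <= m -> l = 0 \/ m <= r -> m = 0 \/ l <= r ->
  r * (k + l + m) <= r * r + 2 * l * m -> 0 < l + m ->
  exists L : 'M['I_n]_n, latin_square L /\
    exists A B : {set 'I_n} * {set 'I_n},
      [/\ subsquare L (k + l) A, subsquare L (k + m) B & A <> B].
Proof.
move=> -> kl km mr lr zle lm.
have [L [rho [LL rhoE Lx]]] := symmetric_latin_square kl km mr lr (subnK zle).
pose A := [set i | (rho i).1]; pose B := [set i | (rho i).2].
exists L; split=> //; exists (A, A), (B, B).
have cardE (f : bool * bool -> bool) :
    #|[set i | f (rho i)]| = \sum_c f c * class_weight k l m r c.
  rewrite -sum1_card (partition_big rho f) /=; last by move=> i; rewrite inE.
  rewrite big_mkcond; apply: eq_bigr => c _; case: ifP => fc; last by rewrite mul0n.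
  rewrite mul1n -rhoE -sum1_card; apply: eq_bigl => i; rewrite !inE.
  by case: eqP => [->|]; rewrite ?fc ?andbF.
split.
- split; first by rewrite /= cardE sum_bool2 /=; lia.
  exists A; apply: latin_on_of_closed => // i j; rewrite !inE => iA jA.
  have := Lx i j; case: (rho i) iA => [[] //= p _]; case: (rho j) jA => [[] //= q _].
  by case: (rho (L i j)) => [[] // s]; case: p; case: q; case: s.
- split; first by rewrite /= cardE sum_bool2 /=; lia.
  exists B; apply: latin_on_of_closed => // i j; rewrite !inE => iA jA.
  have := Lx i j; case: (rho i) iA => [p [] //= _]; case: (rho j) jA => [q [] //= _].
  by case: (rho (L i j)) => [s []] //; case: p; case: q; case: s.
case=> AB.
have empty p : class_weight k l m r (p, ~~ p) = 0.
  rewrite -rhoE; apply/eqP; rewrite cards_eq0; apply/eqP/setP=> i; rewrite !inE.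
  by have /setP/(_ i) := AB; rewrite !inE; case: (rho i) => [[] []] //=; case: p.
by have := empty true; have := empty false => /=; lia.
Qed.

(** The square falls into four blocks, and the two diagonal blocks share the symbol set [A]. The
    second block has rows and columns [B] but symbols [A], so one index set per subsquare would not
    describe it. *)
Lemma two_subsquares_doubling (b : nat) : 0 < b ->
  exists L : 'M['I_(2 * b)]_(2 * b), latin_square L /\
    exists A B : {set 'I_(2 * b)} * {set 'I_(2 * b)},
      [/\ subsquare L b A, subsquare L b B & A <> B].
Proof.
move=> b0; have -> : 2 * b = b + 0 + 0 + b by lia.
have [|||||L [rho [LL rhoE Lx]]] := @symmetric_latin_square b 0 0 b 0; try lia.
pose A := rho @^-1: [set (true, true)]; pose B := rho @^-1: [set (false, false)].
have cA : #|A| = b by rewrite rhoE.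
have cB : #|B| = b by rewrite rhoE.
exists L; split=> //; exists (A, A), (B, B); split.
- split=> //; exists A; apply: latin_on_of_closed => // i j.
  rewrite !inE => /eqP iA /eqP jA; have := Lx i j; rewrite iA jA.
  by case: (rho (L i j)) => [[] []].
- split=> //; exists A; apply: latin_on_of_closed => //=; rewrite ?cA ?cB //.
  move=> i j; rewrite !inE => /eqP iA /eqP jA; have := Lx i j; rewrite iA jA.
  by case: (rho (L i j)) => [[] []].
case=> AB; have /card_gt0P[i iA] : 0 < #|A| by rewrite cA.
by move: (iA); rewrite {1}AB !inE in iA *; move/eqP: iA => ->.
Qed.

Lemma two_subsquares_sufficient (n a b : nat) : 1 < a -> a <= b -> b < n ->
  2 * b <= n -> (n = 2 * b + 1 -> ~~ odd a -> 3 * a <= 2 * (b + 1)) ->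
  (n = 2 * b -> odd a -> a = b \/ 2 * a <= b) ->
  exists L : 'M['I_n]_n, latin_square L /\
    exists A B : {set 'I_n} * {set 'I_n},
      [/\ subsquare L a A, subsquare L b B & A <> B].
Proof.
move=> a1 ab bn n2b h1 h0.
pose t := n - 2 * b; have nt : n = 2 * b + t by rewrite subnKC.
suff : (n = 2 * b /\ a = b) \/ exists k l m r,
    [/\ [/\ n = k + l + m + r, a = k + l & b = k + m],
         [/\ l = 0 \/ k <= l, m = 0 \/ k <= m, l = 0 \/ m <= r & m = 0 \/ l <= r],
         r * (k + l + m) <= r * r + 2 * l * m & 0 < l + m].
  case=> [[-> ->]|[k [l [m [r [[nE -> ->] [kl km mr lr] zle lm]]]]]].
    by apply: two_subsquares_doubling; lia.
  exact: (@two_subsquares_of_weights n k l m r).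
(* If [a <= t], the index sets can be taken disjoint. *)
have [at_|ta] := leqP a t.
  right; exists 0, a, b, (b + t - a).
  have [e te] : exists e, t = a + e by exists (t - a); lia.
  have -> : b + t - a = b + e by lia.
  split; [split; lia | split; lia | nia | lia].
(* As in the crossing case, [l - k] is at most [t], and it has the parity of [a = 2 * k + (l - k)].
   The choice is [t] if the parity fits and [t.-1] otherwise. *)
have [par|par] := eqVneq (odd t) (odd a).
  pose k := (a - t)./2; have ak : a = 2 * k + t.
    have : ~~ odd (a - t) by rewrite oddB 1?ltnW // par addbb.
    rewrite /k; lia.
  right; exists k, (k + t), (b - k), (b - k).
  have [m mE] : exists m, b = k + m by exists (b - k); lia.
  have -> : b - k = m by lia.
  split; [split; lia | split; lia | nia | lia].
(* For [t = 0] and [a] odd no crossing pair exists: either the doubling or a nested pair is used. *)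
have [t0|tp] := posnP t.
  have oa : odd a by move: par; rewrite t0; case: (odd a).
  case: h0 => // [|ab'|ab2]; [lia | left; lia | right].
  exists a, 0, (b - a), b.
  have [m mE] : exists m, b = a + m by exists (b - a); lia.
  have -> : b - a = m by lia.
  split; [split; lia | split; lia | nia | lia].
pose k := (a - t.-1)./2; have ak : a = 2 * k + t.-1.
  have : ~~ odd (a - t.-1) by move: par; rewrite oddB; lia.
  rewrite /k; lia.
right; exists k, (k + t.-1), (b - k), (b - k).+1.
have [m mE] : exists m, b = k + m by exists (b - k); lia.
have -> : b - k = m by lia.
(* This is condition (b), with [a = 2 * k] and [b = k + m]. *)
have k3 : t = 1 -> 2 * k <= m + 1.
  move=> t1; have ea : ~~ odd a by move: par; rewrite t1; case: (odd a).
  have := h1 _ ea; lia.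
split; [split; lia | split; lia | | lia].
have km : k + t.-1 <= m by lia.
have {}k3 : t.-1 = 0 -> 2 * k <= m + 1 by move=> ?; apply: k3; lia.
move: (t.-1) k3 km => d k3 km.
(* Nonnegativity of [z] reduces to this for [l = k + d] and [r = m + 1]; only [d = 0] needs
   condition (b). *)
have : 2 * k + d <= m + 1 + d * m.
  case: d k3 km => [|d] k3 km; first by lia.
  by clear -km; nia.
by clear; nia.
Qed.

Theorem theorem1p6 (a b n : nat) (ha : 1 < a) (hab : a <= b) (hbn : b < n) :
  (exists L : 'M['I_n]_n, latin_square L /\
     exists A B : {set 'I_n} * {set 'I_n},
       [/\ subsquare L a A, subsquare L b B & A <> B])
  <->
  [/\ 2 * b <= n,
      (n = 2 * b + 1 -> ~~ odd a -> 3 * a <= 2 * (b + 1))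
    & (n = 2 * b -> odd a -> a = b \/ 2 * a <= b)].
Proof.
split=> [[L [LL [A [B [SA SB AB]]]]]|[n2b h1 h0]].
  exact: (two_subsquares_necessary LL ha hab hbn SA SB AB).
exact: two_subsquares_sufficient.
Qed.
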